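(* Let $k\geq 2$ be a fixed integer. For every coloring $\Delta\colon\mathbb{N}\to\mathbb{N}$ there exist infinitely many positive integers $x_1<x_2<\cdots$ such that one of the following holds: (i) $\Delta(\sum_{i\in I}x_i)=\Delta(\sum_{j\in J}x_j)$ for all $I,J\in\binom{\mathbb{N}}{k}$; or (ii) $\Delta(\sum_{i\in I}x_i)=\Delta(\sum_{j\in J}x_j)$ if and only if $I=J$, for all $I,J\in\binom{\mathbb{N}}{k}$; or (iii) $\Delta(\sum_{i\in I}x_i)=\Delta(\sum_{j\in J}x_j)$ if and only if $\max I=\max J$, for all $I,J\in\binom{\mathbb{N}}{k}$. None of these three patterns may be omitted without violating the theorem, i.e., for each pattern there is a coloring $\Delta\colon\mathbb{N}\to\mathbb{N}$ such that no infinite increasing sequence of positive integers satisfies either of the other two patterns.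
   Context: $\mathbb{N}$ denotes the set of positive integers; $\binom{\mathbb{N}}{k}$ is the set of $k$-element subsets of $\mathbb{N}$. *)

(* Defs.v *)
From mathcomp Require Import all_boot.
From mathcomp Require Import finmap.
Set Implicit Arguments.
Unset Strict Implicit.
Unset Printing Implicit Defensive.

(* The positive integers are the [n : nat] with [0 < n]. A map on them is a
   function on [nat] whose value at 0 is never used. *)

Definition coloring (Delta : nat -> nat) : Prop :=
  forall n, 0 < n -> 0 < Delta n.

Definition increasing_seq (x : nat -> nat) : Prop :=
  (forall i, 0 < i -> 0 < x i) /\
  (forall i j, 0 < i -> i < j -> x i < x j).

Definition ksubset (k : nat) (I : {fset nat}) : Prop :=
  (forall i, i \in I -> 0 < i) /\ #|` I|%fset = k.

Definition sum_over (x : nat -> nat) (I : {fset nat}) : nat :=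
  \sum_(i <- I) x i.

Definition max_of (I : {fset nat}) : nat := \max_(i <- I) i.

Definition pattern_constant (k : nat) (Delta x : nat -> nat) : Prop :=
  forall I J : {fset nat}, ksubset k I -> ksubset k J ->
    Delta (sum_over x I) = Delta (sum_over x J).

Definition pattern_injective (k : nat) (Delta x : nat -> nat) : Prop :=
  forall I J : {fset nat}, ksubset k I -> ksubset k J ->
    (Delta (sum_over x I) = Delta (sum_over x J) <-> I = J).

Definition pattern_max (k : nat) (Delta x : nat -> nat) : Prop :=
  forall I J : {fset nat}, ksubset k I -> ksubset k J ->
    (Delta (sum_over x I) = Delta (sum_over x J) <-> max_of I = max_of J).

(* Main.v *)
Require Import Defs.
From mathcomp Require Import all_boot.
From mathcomp Require Import finmap.
From mathcomp Require Import boolp classical_sets filter.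

(**
  Put [f t := Delta (k * t)] and fix a nonprincipal idempotent ultrafilter [V]
  on [nat], obtained by Ellis' argument carried out with filters: a maximal
  filter playing the role of a closed subsemigroup of the Stone-Cech
  compactification.  Read [V [set z | P z]] as a quantifier "for V-most z".

  If for some [n], for V-most [y] and V-most [z], [f (n + y + z) = f (n + z)],
  then a sequence [y] can be chosen greedily along which [f (n + sum of y over I)]
  depends only on [max I]; it is constant or injective in [max I] according to
  whether [z |-> f (n + z)] is constant on a set of [V] or not.  If no such [n]
  exists, a greedy choice makes [f] injective on all finite sums.  Finally
  [x i := n + k * y i] turns a sum over a [k]-set [I] into [k] times
  [n + sum of y over I].

  For the necessity of the patterns, use a constant colouring, the identity and
  the binary logarithm: for the last one, the sums [x i + T], with [T] a fixed
  sum of larger terms and [i = 1, 2, 3], take at most two colours.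
*)

(** * Addition of filters and Ellis' idempotent ultrafilter *)

Local Open Scope classical_set_scope.

(** On ultrafilters this is the addition of the Stone-Cech compactification of [nat]. *)
Definition filter_add (F G : set_system nat) : set_system nat :=
  [set A | F [set x | G [set y | A (x + y)]]].

(* The filter form of a nonempty closed subsemigroup of nonprincipal
   ultrafilters: [F] is recovered from the set of ultrafilters extending it. *)
Definition additive_filter (F : set_system nat) : Prop :=
  [/\ ProperFilter F, forall n, F [set m | n < m]
    & forall V, UltraFilter V -> F `<=` V -> F `<=` filter_add F V].

Lemma filter_setC {T : Type} (F : set_system T) (A : set T) :
  ProperFilter F -> F A -> ~ F (~` A).
Proof. by move=> PF FA /(filterI FA); rewrite setICr; exact: filter_not_empty. Qed.

Lemma ultrafilterNP {T : Type} {V : set_system T} {A : set T} :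
  UltraFilter V -> V (~` A) <-> ~ V A.
Proof.
move=> UV; split; last by case: (in_ultra_setVsetC A UV).
by move=> VnA VA; exact: filter_setC VnA.
Qed.

Lemma ultrafilter_sub_eq {T : Type} (V W : set_system T) :
  UltraFilter V -> ProperFilter W -> V `<=` W -> W = V.
Proof. by move=> UV PW; exact: max_filter. Qed.

Lemma dichotomy_ultrafilter {T : Type} (V : set_system T) :
  ProperFilter V -> (forall A, V A \/ V (~` A)) -> UltraFilter V.
Proof.
move=> PV VVC; split=> // G PG VG; apply/seteqP; split=> // A GA.
by have [//|/VG /(filter_setC _ _ PG GA)] := VVC A.
Qed.

Lemma filter_add_proper (F G : set_system nat) :
  ProperFilter F -> ProperFilter G -> ProperFilter (filter_add F G).
Proof.
move=> PF PG; split; last split.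
- by move=> /(@filter_ex _ F PF)[x]; exact: (filter_not_empty G).
- by apply: (@filterS _ F _ setT) filterT => x _; exact: filterT.
- by move=> A B; apply: (@filterS2 _ F) => x; apply: filterS2.
- by move=> A B AB; apply: (@filterS _ F) => x; apply: filterS => y; exact: AB.
Qed.

Lemma filter_add_ultra (V W : set_system nat) :
  UltraFilter V -> UltraFilter W -> UltraFilter (filter_add V W).
Proof.
move=> UV UW; apply: dichotomy_ultrafilter; first exact: filter_add_proper.
move=> A; have [|VnA] := in_ultra_setVsetC [set x | W [set y | A (x + y)]] UV.
  by left.
by right; apply: (@filterS _ V) VnA => x /(ultrafilterNP UW).
Qed.

Lemma filter_addS (F F' G G' : set_system nat) :
  ProperFilter F' -> F `<=` F' -> G `<=` G' ->
  filter_add F G `<=` filter_add F' G'.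
Proof. by move=> PF FF' GG' A /FF'; apply: (@filterS _ F') => x; exact: GG'. Qed.

Definition translate_filter (F V W : set_system nat) : set_system nat :=
  [set C | exists B A, [/\ F B, W A &
     B `&` [set x | V [set y | A (x + y)]] `<=` C]].

(* The ultrafilters extending [translate_filter F V W] are the [s] extending
   [F] with [s + V = W]. *)
Lemma translate_filter_proper (F V W : set_system nat) :
  ProperFilter F -> UltraFilter V -> UltraFilter W ->
  filter_add F V `<=` W -> ProperFilter (translate_filter F V W).
Proof.
move=> PF UV UW FVW; split; last split.
- move=> [B [A [FB WA BA]]].
  (* If [B] missed the set of [x] with [V [set y | A (x + y)]], then each [x] in [B] would put the
     translate of the complement of [A] in [V], so that this complement would lie in
     [filter_add F V], hence in [W]. *)
  suff : W (~` A) by move/ultrafilterNP; apply.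
  apply: FVW; apply: (@filterS _ F) FB => x Bx; apply/ultrafilterNP => VA.
  exact: (BA x).
- by exists setT, setT; split=> //; exact: filterT.
- move=> C C' [B [A [FB WA BAC]]] [B' [A' [FB' WA' BAC']]].
  exists (B `&` B'), (A `&` A'); split; [exact: filterI|exact: filterI|].
  move=> x [[Bx B'x] VAA']; split.
    by apply: BAC; split=> //; apply: filterS VAA' => y [].
  by apply: BAC'; split=> //; apply: filterS VAA' => y [].
- move=> C C' CC' [B [A [FB WA BAC]]]; exists B, A; split=> //.
  exact: subset_trans CC'.
Qed.

Lemma sub_translate_filter (F V W : set_system nat) :
  UltraFilter V -> UltraFilter W -> F `<=` translate_filter F V W.
Proof.
by move=> UV UW A FA; exists A, setT; split=> [||x []] //; exact: filterT.
Qed.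

Lemma translate_filterP (F V W s : set_system nat) :
  ProperFilter F -> UltraFilter V -> UltraFilter W -> UltraFilter s ->
  translate_filter F V W `<=` s -> filter_add s V = W.
Proof.
move=> PF UV UW Us sub; apply: ultrafilter_sub_eq.
  exact: filter_add_proper.
move=> A WA; apply: sub; exists setT, A; split=> [||x []] //.
exact: filterT.
Qed.

(** If [C] is a subsemigroup containing [V], so is [C + V]. An ultrafilter [W] extending [F + V] is
    [s + V] with [s] extending [F]; then [V + s] extends [F], so [F] is contained in [F + (V + s)],
    and associativity finishes. *)
Lemma additive_filter_add (F V : set_system nat) :
  additive_filter F -> UltraFilter V -> F `<=` V ->
  additive_filter (filter_add F V).
Proof.
move=> [PF tailF addF] UV FV; split.
- exact: filter_add_proper.
- by move=> n; exact: (addF V).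
move=> W UW FVW A FVA.
have Ptr := translate_filter_proper _ _ _ PF UV UW FVW.
have [s [Us trs]] := ultraFilterLemma Ptr.
have Fs : F `<=` s := subset_trans (sub_translate_filter _ _ _ UV UW) trs.
have <- := translate_filterP _ _ _ _ PF UV UW Us trs.
have FVs : F `<=` filter_add V s.
  by apply: subset_trans (addF s Us Fs) _; exact: filter_addS.
have := addF _ (filter_add_ultra _ _ UV Us) FVs _ FVA.
apply: (@filterS _ F) => x; apply: (@filterS _ V) => y.
by apply: (@filterS _ s) => z; apply: filterS => t; rewrite /= !addnA.
Qed.

(** The solutions [s] of [s + V = V] are closed under addition, since
    [(s + s') + V = s + (s' + V) = V]. The inclusion of [filter_add F V] in [V] provides a solution
    extending [F]. *)
Lemma additive_translate_filter (F V : set_system nat) :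
  additive_filter F -> UltraFilter V -> F `<=` V -> filter_add F V `<=` V ->
  additive_filter (translate_filter F V V).
Proof.
move=> [PF tailF addF] UV FV FVV.
have PG := translate_filter_proper _ _ _ PF UV UV FVV.
have FG := sub_translate_filter F V V UV UV.
split=> //; first by move=> n; exact/FG/tailF.
move=> W UW GW C [B [A [FB VA BAC]]].
have WV := translate_filterP _ _ _ _ PF UV UV UW GW.
have GB : filter_add (translate_filter F V V) W B.
  have FW : F `<=` W by exact: subset_trans GW.
  by apply/FG/addF.
have GA : translate_filter F V V [set x | V [set y | A (x + y)]].
  by exists setT, A; split=> [||x []] //; exact: filterT.
apply: (@filterS2 _ (translate_filter F V V)) GB GA => x Bx; rewrite /= -{1}WV => WVA.
apply: filterS2 Bx WVA => y By VAy; apply: BAC; split=> //=.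
by apply: filterS VAy => z; rewrite /= addnA.
Qed.

(* Zorn_bigcup also asks for the union of the empty chain, hence the extra
   disjunct [F = set0]. *)
Lemma additive_filter_maximal :
  exists2 F, additive_filter F &
    forall G, additive_filter G -> F `<=` G -> G = F.
Proof.
pose P : set (set_system nat) := [set F | F = set0 \/ additive_filter F].
have [C CP Ctot|F [PF Fmax]] := @Zorn_bigcup _ P.
  have [[G CG addG]|noG] := pselect (exists2 G, C G & additive_filter G); last first.
    left; apply/seteqP; split=> // A [G CG GA].
    have [G0|addG] := CP _ CG; first by rewrite G0 in GA.
    by apply: noG; exists G.
  have addC H A : C H -> H A -> additive_filter H.
    by move=> CH HA; have [H0|//] := CP _ CH; rewrite H0 in HA.
  have [PG tailG _] := addG.
  right; split.
  - split; last split.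
    + move=> [H CH H0]; have [PH _ _] := addC _ _ CH H0.
      by have := @filter_not_empty _ H PH.
    + by exists G => //; exact: filterT.
    + move=> A B [H CH HA] [K CK KB].
      have [PH _ _] := addC _ _ CH HA; have [PK _ _] := addC _ _ CK KB.
      have [HK|KH] := Ctot _ _ CH CK.
        by exists K => //; apply: filterI => //; exact: HK.
      by exists H => //; apply: filterI => //; exact: KH.
    + move=> A B AB [H CH HA]; have [PH _ _] := addC _ _ CH HA.
      by exists H => //; apply: filterS HA.
  - by move=> n; exists G.
  - move=> V UV CV A [H CH HA]; have [PH _ addH] := addC _ _ CH HA.
    exists H => //; apply: (addH V) => //.
    by apply: subset_trans CV => B HB; exists H.
(* The cofinite filter is additive, which rules out [set0] as a maximal element. *)
have addF0 : additive_filter [set A : set nat | exists n, forall m, n < m -> A m].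
  split.
  - split; last split.
    + by move=> [n /(_ n.+1)]; apply.
    + by exists 0.
    + move=> A B [n nA] [m mB]; exists (maxn n m) => i; rewrite gtn_max.
      by case/andP => ni mi; split; [exact: nA|exact: mB].
    + by move=> A B AB [n nA]; exists n => m /nA; exact: AB.
  - by move=> n; exists n.
  - move=> V UV tailV A [n nA]; exists 0 => x _; apply: tailV.
    by exists n => y ny; apply: nA; rewrite ltn_addl.
have addF : additive_filter F.
  case: PF => // F0; exfalso; apply: (Fmax _ _ (or_intror addF0)); rewrite F0.
  by split=> [A //|/(_ setT)]; apply; exists 0.
exists F => // G addG FG; apply/seteqP; split=> //.
by apply: contrapT => GF; apply: (Fmax G); [split|right].
Qed.

(** A maximal additive filter [F] stands for a minimal closed subsemigroup. For any [V] extending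
    [F], both [F + V] and the filter of solutions of [s + V = V] must equal [F], so [V] is itself
    such a solution. *)
Lemma idempotent_ultrafilter_exists :
  exists V : set_system nat, [/\ UltraFilter V,
    forall n, V [set m | n < m] & filter_add V V = V].
Proof.
have [F addF Fmax] := additive_filter_maximal.
have [PF tailF subF] := addF.
have [V [UV FV]] := ultraFilterLemma PF.
exists V; split=> //; first by move=> n; exact/FV/tailF.
have FVE : filter_add F V = F.
  by apply: Fmax; [exact: additive_filter_add|exact: subF].
have GE : translate_filter F V V = F.
  apply: Fmax; last exact: sub_translate_filter.
  by apply: additive_translate_filter => //; rewrite FVE.
by apply: (translate_filterP F); rewrite ?GE.
Qed.

Local Open Scope fset_scope.
Local Open Scope nat_scope.

(** * Greedy sequences and finite index sets *)

Lemma filter_sequence {V : set_system nat} (Q : seq nat -> Prop) :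
  ProperFilter V -> (forall n, V [set m | n < m]) ->
  Q [::] -> (forall s, Q s -> V [set z | Q (rcons s z)]) ->
  exists y : nat -> nat, [/\ 0 < y 0, forall i j, i < j -> y i < y j
    & forall m, Q (mkseq y m)].
Proof.
move=> PV tailV Q0 QS.
(* The implication under the quantifier lets [choice] give a total function, with value 0 allowed
   off [Q]. *)
have step s : exists z, Q s -> Q (rcons s z) /\ \max_(t <- s) t < z.
  have [Qs|nQs] := pselect (Q s); last by exists 0.
  have [z [Qz sz]] := filter_ex (filterI (QS s Qs) (tailV (\max_(t <- s) t))).
  by exists z.
have [next nextP] := choice step.
pose pre m := iter m (fun s => rcons s (next s)) [::].
have mkE m : mkseq (next \o pre) m = pre m.
  by elim: m => [//|m IH]; rewrite mkseqS IH.
have Qpre m : Q (pre m) by elim: m => [//|m /nextP[]].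
exists (next \o pre); split=> [|i j ij|m]; last by rewrite mkE.
  by case: (nextP _ Q0) => _; exact: leq_ltn_trans.
case: (nextP _ (Qpre j)) => _; apply: leq_ltn_trans.
apply: (bigmaxn_sup_seq (next (pre i))) => //.
by rewrite -(mkE j); apply/mapP; exists i; rewrite ?mem_iota.
Qed.

Lemma filter_fsubset {V : set_system nat} (B : {fset nat})
    (R : {fset nat} -> nat -> Prop) :
  Filter V -> (forall I, I `<=` B -> V [set z | R I z]) ->
  V [set z | forall I, I `<=` B -> R I z].
Proof.
move=> FV VR.
have VRB : V (\bigcap_(I in [set` fpowerset B]) [set z | R I z]).
  by apply: filter_bigI => I; rewrite fpowersetE; exact: VR.
by apply: filterS VRB => z Rz I IB; apply: Rz; rewrite /= fpowersetE.
Qed.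

Definition below (m : nat) : {fset nat} := [fset i in iota 0 m].

Lemma in_below m i : (i \in below m) = (i < m).
Proof. by rewrite !inE /= mem_iota. Qed.

Lemma fsubset_belowP (I : {fset nat}) m :
  reflect {in I, forall i, i < m} (I `<=` below m).
Proof.
by apply: (iffP (@fsubsetP _ _ _)) => Im i iI; have := Im i iI; rewrite in_below.
Qed.

Lemma fsubset_below0 (I : {fset nat}) : I `<=` below 0 -> I = fset0.
Proof. by move/fsubset_belowP => I0; apply/fsetP => i; apply/negP => /I0. Qed.

(** The case split of every greedy step: the index set either omits the new index or consists of it
    and older ones. *)
Lemma fsubset_belowS (I : {fset nat}) m : I `<=` below m.+1 ->
  I `<=` below m \/ exists2 I' : {fset nat}, I' `<=` below m & I = m |` I'.
Proof.
move=> /fsubset_belowP IB; have [mI|mNI] := boolP (m \in I); last first.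
  left; apply/fsubset_belowP => i iI.
  by rewrite ltn_neqAle -ltnS IB // andbT; apply: contraNneq mNI => <-.
right; exists (I `\ m); last by rewrite fsetD1K.
apply/fsubset_belowP => i; rewrite !inE => /andP[im iI].
by rewrite ltn_neqAle im -ltnS IB.
Qed.

Lemma notin_fsubset_below (I : {fset nat}) m : I `<=` below m -> m \notin I.
Proof. by move/fsubset_belowP => Im; apply/negP => /Im; rewrite ltnn. Qed.

Lemma max_of_fsubset_below (I : {fset nat}) : I `<=` below (max_of I).+1.
Proof. by apply/fsubset_belowP => i iI; rewrite ltnS; exact: (bigmaxn_sup_seq i). Qed.

Lemma max_ofU1 (I : {fset nat}) m : I `<=` below m -> max_of (m |` I) = m.
Proof.
move=> IB; rewrite /max_of big_fsetU1 ?notin_fsubset_below //=.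
apply/maxn_idPl; apply/bigmax_leqP_seq => i iI _.
by apply: ltnW; move/fsubset_belowP: IB; apply.
Qed.

Lemma max_of_lt (I : {fset nat}) m :
  I `<=` below m -> I != fset0 -> max_of I < m.
Proof.
case: m => [/fsubset_below0->|m IB _]; first by rewrite eqxx.
rewrite ltnS; apply/bigmax_leqP_seq => i iI _.
by rewrite -ltnS; move/fsubset_belowP: IB; apply.
Qed.

Lemma eq_sum_over (x y : nat -> nat) (I : {fset nat}) m :
  I `<=` below m -> (forall i, i < m -> x i = y i) ->
  sum_over x I = sum_over y I.
Proof.
by move/fsubset_belowP => IB xy; apply: eq_big_seq => i /IB; exact: xy.
Qed.

Lemma sum_over_mkseq (y : nat -> nat) (I : {fset nat}) m :
  I `<=` below m -> sum_over (nth 0 (mkseq y m)) I = sum_over y I.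
Proof. by move=> /eq_sum_over; apply=> i im; rewrite nth_mkseq. Qed.

Lemma sum_over_rcons (s : seq nat) z (I : {fset nat}) :
  I `<=` below (size s) ->
  sum_over (nth 0 (rcons s z)) I = sum_over (nth 0 s) I.
Proof. by move=> /eq_sum_over; apply=> i im; rewrite nth_rcons im. Qed.

Lemma sum_over_rconsU1 (s : seq nat) z (I : {fset nat}) :
  I `<=` below (size s) ->
  sum_over (nth 0 (rcons s z)) (size s |` I) = sum_over (nth 0 s) I + z.
Proof.
move=> IB; rewrite /sum_over big_fsetU1 ?notin_fsubset_below //= nth_rcons.
by rewrite ltnn eqxx addnC -/(sum_over _ _) sum_over_rcons.
Qed.

(** * Canonical sequences for finite sums *)

Lemma idempotent_add {V : set_system nat} {A : set nat} :
  filter_add V V = V -> V A -> V [set x | V [set y | A (x + y)]].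
Proof. by move=> VV VA; have : filter_add V V A by rewrite VV. Qed.

(** The greedy choice keeps every earlier partial sum negligible before V-most next terms. The extra
    invariant [R] later forces constancy or injectivity in the maximum. *)
Lemma max_determined_sequence {V : set_system nat} (f : nat -> nat) n
    (R : seq nat -> Prop) :
  ProperFilter V -> (forall m, V [set i | m < i]) -> filter_add V V = V ->
  V [set y | V [set z | f (n + y + z) = f (n + z)]] ->
  R [::] -> (forall s, R s -> V [set z | R (rcons s z)]) ->
  exists y : nat -> nat, [/\ 0 < y 0, forall i j, i < j -> y i < y j,
    forall I : {fset nat}, I != fset0 ->
      f (n + sum_over y I) = f (n + y (max_of I))
    & forall m, R (mkseq y m)].
Proof.
move=> PV tailV VV Vf R0 RS.
pose Q s := [/\ R s,
  forall I, I `<=` below (size s) ->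
    V [set z | f (n + sum_over (nth 0 s) I + z) = f (n + z)] &
  forall I, I `<=` below (size s) -> I != fset0 ->
    f (n + sum_over (nth 0 s) I) = f (n + nth 0 s (max_of I))].
have [||y [y0 ymono Qy]] := @filter_sequence V Q PV tailV.
- split=> // I /fsubset_below0 -> //.
  by apply: filterS filterT => z _ /=; rewrite /sum_over big_seq_fset0 addn0.
- move=> s [Rs Vs fs].
  pose S (I : {fset nat}) z := f (n + sum_over (nth 0 s) I + z) = f (n + z) /\
    V [set z' | f (n + (sum_over (nth 0 s) I + z) + z') = f (n + z')].
  have VS : V [set z | forall I, I `<=` below (size s) -> S I z].
    apply: filter_fsubset => I IB; apply: filterI (Vs I IB) _.
    (* With [u] the old sum, idempotence gives [f (n + u + z + z') = f (n + z + z')] for V-most [z]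
       and [z']; [Vf] then removes [z]. *)
    apply: filterS2 (idempotent_add VV (Vs I IB)) Vf => z.
    by apply: filterS2 => z' /=; rewrite !addnA => ->.
  apply: filterS2 (RS s Rs) VS => z Rz Sz; split=> // I; rewrite size_rcons.
    case/fsubset_belowS => [IB|[J JB ->]].
      by rewrite sum_over_rcons //; exact: Vs.
    by rewrite sum_over_rconsU1 //; case: (Sz J JB).
  case/fsubset_belowS => [IB I0|[J JB ->] _].
    by rewrite sum_over_rcons // nth_rcons max_of_lt //; exact: fs.
  rewrite sum_over_rconsU1 // max_ofU1 // nth_rcons ltnn eqxx addnA.
  by case: (Sz J JB).
exists y; split=> // [I I0|m]; last by case: (Qy m).
have IB := max_of_fsubset_below I.
have [_ _ /(_ I)] := Qy (max_of I).+1; rewrite size_mkseq sum_over_mkseq //.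
by rewrite nth_mkseq //; apply.
Qed.

(* Otherwise [f (v + z + z')] and [f (v + z + t + z')] would both equal
   [f (u + z')], contradicting the hypothesis at [n = v + z]. *)
Lemma sum_separation {V : set_system nat} (f : nat -> nat) u v :
  UltraFilter V -> filter_add V V = V ->
  (forall n, V [set y | V [set z | f (n + y + z) <> f (n + z)]]) ->
  V [set z | V [set z' | f (u + z') <> f (v + z + z')]].
Proof.
move=> UV VV Vf.
pose E := [set z | V [set z' | f (u + z') = f (v + z + z')]].
have [VE|] := in_ultra_setVsetC E UV; last first.
  by apply: filterS => z /(ultrafilterNP UV).
have [z [Ez VEz]] := filter_ex (filterI VE (idempotent_add VV VE)).
have [t [Ezt nt]] := filter_ex (filterI VEz (Vf (v + z))).
have [z' [[e1 e2]]] := filter_ex (filterI (filterI Ez Ezt) nt).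
by case; rewrite -addnA -addnA addnA -[RHS]e1 e2 !addnA.
Qed.

Lemma injective_sequence {V : set_system nat} (f : nat -> nat) :
  UltraFilter V -> (forall m, V [set i | m < i]) -> filter_add V V = V ->
  (forall n c, V [set z | f (n + z) <> c]) ->
  (forall n, V [set y | V [set z | f (n + y + z) <> f (n + z)]]) ->
  exists y : nat -> nat, [/\ 0 < y 0, forall i j, i < j -> y i < y j
    & forall I J : {fset nat}, I <> J -> f (sum_over y I) <> f (sum_over y J)].
Proof.
move=> UV tailV VV Vc Vf.
pose Q s := forall I J : {fset nat},
  I `<=` below (size s) -> J `<=` below (size s) -> I <> J ->
  f (sum_over (nth 0 s) I) <> f (sum_over (nth 0 s) J) /\
  V [set z | f (sum_over (nth 0 s) I + z) <> f (sum_over (nth 0 s) J + z)].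
have [||y [y0 ymono Qy]] := @filter_sequence V Q _ tailV.
- by move=> I J /fsubset_below0-> /fsubset_below0->.
- move=> s Qs; set u := sum_over (nth 0 s).
  (* The first clause serves when both index sets receive the new term, the other two when only the
     second does. The latter carry no condition [I <> J]: adding the new index to one side already
     makes the sets distinct. *)
  pose S (I J : {fset nat}) z :=
    [/\ I <> J -> f (u I + z) <> f (u J + z) /\
        V [set z' | f (u I + z + z') <> f (u J + z + z')],
      f (u I) <> f (u J + z) &
      V [set z' | f (u I + z') <> f (u J + z + z')]].
  have VS : V [set z | forall I, I `<=` below (size s) ->
                      forall J, J `<=` below (size s) -> S I J z].
    apply: filter_fsubset => I IB; apply: filter_fsubset => J JB.
    have Vu : V [set z | I <> J -> f (u I + z) <> f (u J + z) /\
                 V [set z' | f (u I + z + z') <> f (u J + z + z')]].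
      have [->|IJ] := pselect (I = J).
        by apply: filterS filterT => z _ /(_ erefl).
      case: (Qs I J IB JB IJ) => _ VIJ.
      apply: filterS2 VIJ (idempotent_add VV VIJ) => z fz Vz _; split=> //.
      by apply: filterS Vz => z'; rewrite /= !addnA.
    (* [Vd] separates the sums themselves in the mixed case, and [Ve] keeps them separated after a
       further term. *)
    have Vd := Vc (u J) (f (u I)).
    have Ve := sum_separation f (u I) (u J) UV VV Vf.
    by apply: filterS3 Vu Vd Ve => z ? /nesym ? ?; split.
  apply: filterS VS => z Sz I J; rewrite size_rcons.
  case/fsubset_belowS => [IB|[I' IB ->]]; case/fsubset_belowS => [JB|[J' JB ->]].
  - by rewrite !sum_over_rcons //; exact: Qs.
  - by rewrite sum_over_rcons // sum_over_rconsU1 //; case: (Sz I IB J' JB).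
  - rewrite sum_over_rconsU1 // sum_over_rcons // => _.
    case: (Sz J JB I' IB) => _ /nesym fIJ VIJ; split=> //.
    by apply: filterS VIJ => z' /nesym.
  - have [<- //|IJ _] := pselect (I' = J').
    by rewrite !sum_over_rconsU1 //; case: (Sz I' IB J' JB) => + _ _; apply.
exists y; split=> // I J IJ.
pose m := maxn (max_of I).+1 (max_of J).+1.
have bel K : (max_of K < m)%N -> K `<=` below m.
  move=> Km; apply: fsubset_trans (max_of_fsubset_below K) _.
  apply/fsubset_belowP => i; rewrite in_below => iK; exact: leq_trans Km.
have IB : I `<=` below m by apply: bel; rewrite leq_maxl.
have JB : J `<=` below m by apply: bel; rewrite leq_maxr.
have [] := Qy m I J; rewrite ?size_mkseq //.
by rewrite !sum_over_mkseq.
Qed.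

Theorem canonical_finite_sums (f : nat -> nat) :
  exists n (y : nat -> nat), [/\ 0 < y 0, forall i j, i < j -> y i < y j &
    [\/ forall I J : {fset nat}, I != fset0 -> J != fset0 ->
          f (n + sum_over y I) = f (n + sum_over y J),
        forall I J : {fset nat},
          f (n + sum_over y I) = f (n + sum_over y J) -> I = J |
        forall I J : {fset nat}, I != fset0 -> J != fset0 ->
          f (n + sum_over y I) = f (n + sum_over y J) <-> max_of I = max_of J]].
Proof.
have [V [UV tailV VV]] := idempotent_ultrafilter_exists.
have [[n Vn]|noV] := pselect (exists n,
    V [set y | V [set z | f (n + y + z) = f (n + z)]]).
  (* A colour taken V-almost everywhere leads to the constant pattern, its absence to the max
     pattern. *)
  have [[c Vc]|noc] := pselect (exists c, V [set z | f (n + z) = c]).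
    pose R (s : seq nat) := {in s, forall t, f (n + t) = c}.
    have [//||y [y0 ymono fmax Ry]] :=
        max_determined_sequence f n R _ tailV VV Vn.
      move=> s Rs; apply: filterS Vc => z fz t.
      by rewrite mem_rcons inE => /predU1P[->|/Rs].
    have fc i : f (n + y i) = c.
      by apply: (Ry i.+1); apply/mapP; exists i; rewrite ?mem_iota ?add0n ?ltnSn.
    by exists n, y; split=> //; apply: Or31 => I J I0 J0; rewrite !fmax // !fc.
  pose R s := forall i j, i < j < size s ->
    f (n + nth 0 s i) <> f (n + nth 0 s j).
  have [||y [y0 ymono fmax Ry]] := max_determined_sequence f n R _ tailV VV Vn.
  - by move=> i j; rewrite ltn0 andbF.
  - move=> s Rs.
    (* No single colour is taken on a set of [V], so V-most [z] avoid the finitely many colours used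
       so far. *)
    have Vs : V [set z | forall t, t \in s -> f (n + z) <> f (n + t)].
      elim: (s) => [|t s' IH]; first by apply: filterS filterT.
      have Vt : V [set z | f (n + z) <> f (n + t)].
        by apply/(ultrafilterNP UV) => Vt; apply: noc; exists (f (n + t)).
      apply: filterS2 IH Vt => z zs zt t'.
      by rewrite inE => /predU1P[->|/zs].
    apply: filterS Vs => z zs i j; rewrite size_rcons ltnS => /andP[ij js].
    have si := leq_trans ij js; rewrite !nth_rcons si.
    move: js; rewrite leq_eqVlt => /predU1P[->|js].
      by rewrite ltnn eqxx; apply/nesym/zs/mem_nth.
    by rewrite js; apply: Rs; rewrite ij.
  exists n, y; split=> //; apply: Or33 => I J I0 J0; rewrite !fmax //.
  have fy i j : i < j -> f (n + y i) <> f (n + y j).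
    move=> ij; have := Ry j.+1 i j; rewrite size_mkseq !nth_mkseq //.
      by apply; rewrite ij /=.
    exact: ltnW.
  split=> [|-> //]; case: (ltngtP (max_of I) (max_of J)) => // /fy neq fIJ.
    by case: neq.
  by case: neq; rewrite fIJ.
have Vf n : V [set y | V [set z | f (n + y + z) <> f (n + z)]].
  have : ~ V [set y | V [set z | f (n + y + z) = f (n + z)]].
    by move=> Vn; apply: noV; exists n.
  by move/(ultrafilterNP UV); apply: filterS => y /(ultrafilterNP UV).
(* Were [f (n + z) = c] for V-most [z], idempotence would give [f (n + y + z) = c] as well, against
   [noV]. *)
have Vc n c : V [set z | f (n + z) <> c].
  apply/(ultrafilterNP UV) => Vc; apply: noV; exists n.
  apply: filterS (idempotent_add VV Vc) => y Vy.
  by apply: filterS2 Vc Vy => z /= ->; rewrite addnA.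
have [y [y0 ymono finj]] := injective_sequence f UV tailV VV Vc Vf.
exists 0, y; split=> //; apply: Or32 => I J fIJ.
by apply: contrapT => /finj; apply.
Qed.

(** * Passage to [k]-element index sets *)

Lemma ksubset_neq0 k (I : {fset nat}) : 0 < k -> ksubset k I -> I != fset0.
Proof. by move=> k0 [_ Ik]; rewrite -cardfs_gt0 Ik. Qed.

Lemma sum_over_affine (y : nat -> nat) n k (I : {fset nat}) : #|` I| = k ->
  sum_over (fun i => n + k * y i) I = k * (n + sum_over y I).
Proof.
move=> Ik; rewrite /sum_over big_split /= -big_distrr /= mulnDr.
by rewrite big_const_seq count_predT iter_addn_0 Ik mulnC.
Qed.

Lemma exists_canonical_sequence k (Delta : nat -> nat) : 0 < k ->
  exists x : nat -> nat, increasing_seq x /\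
    (pattern_constant k Delta x \/ pattern_injective k Delta x \/
     pattern_max k Delta x).
Proof.
move=> k0.
have [n [y [y0 ymono fP]]] := canonical_finite_sums (fun t => Delta (k * t)).
exists (fun i => n + k * y i); split.
  split=> [i i0|i j _ ij]; last by rewrite ltn_add2l ltn_pmul2l ?ymono.
  by rewrite ltn_addl // muln_gt0 k0 (leq_trans y0) // ltnW // ymono.
have sumE I : ksubset k I ->
    sum_over (fun i => n + k * y i) I = k * (n + sum_over y I).
  by case=> _; exact: sum_over_affine.
case: fP => fP; [left|right; left|right; right] => I J kI kJ; rewrite !sumE //.
- by apply: fP; exact: ksubset_neq0 k0 _.
- by split=> [/fP|->].
- by apply: fP; exact: ksubset_neq0 k0 _.
Qed.

(** * Necessity of the three patterns *)

Definition index_interval (m k : nat) : {fset nat} := [fset i in iota m k].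

Lemma in_index_interval m k i : (i \in index_interval m k) = (m <= i < m + k).
Proof. by rewrite !inE /= mem_iota. Qed.

Lemma card_index_interval m k : #|` index_interval m k| = k.
Proof. by rewrite card_fseq undup_id ?iota_uniq // size_iota. Qed.

Lemma ksubset_index_interval m k : 0 < m -> ksubset k (index_interval m k).
Proof.
move=> m0; split; last exact: card_index_interval.
by move=> i; rewrite in_index_interval => /andP[/(leq_trans m0)].
Qed.

(** For [i = 1, 2, 3] these are [k]-sets that differ only in their least element; for [1 < k] they
    share their maximum. *)
Definition low_index_set (k i : nat) : {fset nat} :=
  i |` index_interval 4 k.-1.

Lemma notin_index_interval m k i : i < m -> i \notin index_interval m k.
Proof. by move=> im; rewrite in_index_interval leqNgt im. Qed.

Lemma ksubset_low_index_set k i : 0 < k -> 0 < i < 4 ->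
  ksubset k (low_index_set k i).
Proof.
move=> k0 /andP[i0 i4]; split.
  move=> j; rewrite in_fset1U in_index_interval => /predU1P[->//|].
  by case/andP => /(@leq_trans 4 1 j isT).
by rewrite cardfsU1 notin_index_interval // card_index_interval add1n prednK.
Qed.

Lemma sum_over_low_index_set x k i : i < 4 ->
  sum_over x (low_index_set k i) = x i + sum_over x (index_interval 4 k.-1).
Proof. by move=> i4; rewrite /sum_over big_fsetU1 //= notin_index_interval. Qed.

Lemma max_of_low_index_set k i : 1 < k -> i < 4 ->
  max_of (low_index_set k i) = max_of (index_interval 4 k.-1).
Proof.
move=> k1 i4; rewrite /max_of big_fsetU1 ?notin_index_interval //=.
apply/maxn_idPr; apply: leq_trans (ltnW i4) _.
by apply: (bigmaxn_sup_seq 4) => //; rewrite in_index_interval /=; case: k k1 => [|[]].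
Qed.

Lemma low_index_set_inj k i j : i < 4 -> j < 4 ->
  low_index_set k i = low_index_set k j -> i = j.
Proof.
move=> i4 j4 /fsetP/(_ i); rewrite !in_fset1U eqxx /= in_index_interval.
by rewrite leqNgt i4 /= orbF => /esym/eqP.
Qed.

Lemma leq_sum_over x (I : {fset nat}) i : i \in I -> x i <= sum_over x I.
Proof. by move=> iI; rewrite /sum_over (big_fsetD1 i) //= leq_addr. Qed.

Lemma leq_increasing_seq x i : increasing_seq x -> 0 < i -> i <= x i.
Proof.
move=> [x0 xmono]; elim: i => // -[|i] IH _; first exact: x0.
by apply: leq_ltn_trans (IH _) (xmono _ _ _ _).
Qed.

(** Two distinct [k]-sets refute injectivity, and the consecutive blocks starting at 1 and at [k.+1]
    have different maxima. *)
Lemma constant_not_injective_max k : 1 < k ->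
  forall x, increasing_seq x ->
    ~ pattern_injective k (fun=> 1) x /\ ~ pattern_max k (fun=> 1) x.
Proof.
move=> k1 x _; have k0 := ltnW k1; split.
  have k1s := ksubset_low_index_set k 1 k0 isT.
  have k2s := ksubset_low_index_set k 2 k0 isT.
  by case/(_ _ _ k1s k2s) => /(_ erefl)/(low_index_set_inj k 1 2 isT isT).
have k1s := ksubset_index_interval 1 k isT.
have k2s := ksubset_index_interval k.+1 k isT.
case/(_ _ _ k1s k2s) => /(_ erefl) eqm _.
have : max_of (index_interval 1 k) <= k.
  apply/bigmax_leqP_seq => i; rewrite in_index_interval => /andP[_].
  by rewrite add1n ltnS.
rewrite eqm leqNgt => /negP; apply.
by apply: (bigmaxn_sup_seq k.+1); rewrite // in_index_interval leqnn -ltn_subLR // subnn.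
Qed.

(** Replacing index 1 by 2 changes the sum but not the maximum, which refutes both patterns at
    once. *)
Lemma identity_not_constant_max k : 1 < k ->
  forall x, increasing_seq x ->
    ~ pattern_constant k id x /\ ~ pattern_max k id x.
Proof.
move=> k1 x [_ xmono]; have k0 := ltnW k1.
have k1s := ksubset_low_index_set k 1 k0 isT.
have k2s := ksubset_low_index_set k 2 k0 isT.
have neq : sum_over x (low_index_set k 1) <> sum_over x (low_index_set k 2).
  rewrite !sum_over_low_index_set // => /addIn x12.
  by have := xmono 1 2 isT isT; rewrite x12 ltnn.
split=> [/(_ _ _ k1s k2s) //|/(_ _ _ k1s k2s)[_]].
by rewrite !max_of_low_index_set // => /(_ erefl).
Qed.

Lemma trunc_log_not_constant_injective k : 1 < k ->
  forall x, increasing_seq x ->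
    ~ pattern_constant k (fun n => (trunc_log 2 n).+1) x /\
    ~ pattern_injective k (fun n => (trunc_log 2 n).+1) x.
Proof.
move=> k1 x xinc; have k0 := ltnW k1; have [x0 xmono] := xinc; split.
  set t := trunc_log 2 (sum_over x (index_interval 1 k)).
  have k1s := ksubset_index_interval 1 k isT.
  have t0 : 0 < 2 ^ t.+1 by rewrite expn_gt0.
  (* Since [x i] is at least [i], a block starting at index [2 ^ t.+1] has a sum of logarithm above
     [t]. *)
  have k2s := ksubset_index_interval (2 ^ t.+1) k t0.
  have big : 2 ^ t.+1 <= sum_over x (index_interval (2 ^ t.+1) k).
    apply: leq_trans (leq_increasing_seq x _ xinc t0) _.
    apply: leq_sum_over; rewrite in_index_interval leqnn.
    by rewrite -ltn_subLR // subnn.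
  move=> /(_ _ _ k1s k2s) [eqt]; have := leq_trunc_log 2 big.
  by rewrite trunc_expnK // -eqt ltnn.
set T := sum_over x (index_interval 4 k.-1).
have T4 : x 4 <= T.
  by apply: leq_sum_over; rewrite in_index_interval; case: (k) k1 => [|[]].
set t := trunc_log 2 T.
(* As [x i < x 4 <= T], the sum [x i + T] lies between [T] and [2 * T], so three sums share two
   possible logarithms. *)
have logE i : 0 < i < 4 ->
    trunc_log 2 (sum_over x (low_index_set k i)) = t \/
    trunc_log 2 (sum_over x (low_index_set k i)) = t.+1.
  move=> /andP[i0 i4]; rewrite sum_over_low_index_set // -/T.
  have xT : x i < T by apply: leq_trans T4; exact: xmono.
  have T0 : 0 < T by exact: leq_ltn_trans xT.
  have lo : t <= trunc_log 2 (x i + T) by apply: leq_trunc_log; exact: leq_addl.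
  have hi : trunc_log 2 (x i + T) < t.+2.
    rewrite ltnS -trunc_log2_double //; apply: leq_trunc_log.
    by rewrite -addnn leq_add2r ltnW.
  move: lo; rewrite leq_eqVlt => /predU1P[->|lo]; [by left|right].
  by apply/eqP; rewrite eqn_leq -ltnS hi.
move=> inj.
have sep i j : 0 < i < 4 -> 0 < j < 4 -> i <> j ->
    trunc_log 2 (sum_over x (low_index_set k i)) <>
    trunc_log 2 (sum_over x (low_index_set k j)).
  move=> Hi Hj ij eqt; apply: ij; apply: (low_index_set_inj k).
  - by case/andP: Hi.
  - by case/andP: Hj.
  - apply/(inj _ _ (ksubset_low_index_set k i k0 Hi) (ksubset_low_index_set k j k0 Hj)).
    by rewrite eqt.
have s12 := sep 1 2 isT isT (fun e => ltac:(discriminate e)).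
have s13 := sep 1 3 isT isT (fun e => ltac:(discriminate e)).
have s23 := sep 2 3 isT isT (fun e => ltac:(discriminate e)).
by case: (logE 1 isT) (logE 2 isT) (logE 3 isT) => [e1|e1] [e2|e2] [e3|e3];
  rewrite e1 e2 e3 in s12 s13 s23.
Qed.

Theorem theorem6p1 (k : nat) (hk : 2 <= k) :
  (forall Delta : nat -> nat, coloring Delta ->
     exists x : nat -> nat, increasing_seq x /\
       (pattern_constant k Delta x \/
        pattern_injective k Delta x \/
        pattern_max k Delta x))
  /\
  (exists Delta : nat -> nat, coloring Delta /\
     forall x : nat -> nat, increasing_seq x ->
       ~ pattern_injective k Delta x /\ ~ pattern_max k Delta x)
  /\
  (exists Delta : nat -> nat, coloring Delta /\
     forall x : nat -> nat, increasing_seq x ->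
       ~ pattern_constant k Delta x /\ ~ pattern_max k Delta x)
  /\
  (exists Delta : nat -> nat, coloring Delta /\
     forall x : nat -> nat, increasing_seq x ->
       ~ pattern_constant k Delta x /\ ~ pattern_injective k Delta x).
Proof.
split; first by move=> Delta _; apply: exists_canonical_sequence; exact: ltnW.
split; first by exists (fun=> 1); split=> //; exact: constant_not_injective_max.
split; first by exists id; split=> //; exact: identity_not_constant_max.
(* The successor keeps colours positive, as [trunc_log 2 1] is 0. *)
exists (fun n => (trunc_log 2 n).+1); split=> //.
exact: trunc_log_not_constant_injective.
Qed.
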